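(* Let $\mathfrak g$ and $\mathfrak h$ be two Lie algebras over a field $\mathbb K$ of characteristic zero, and let $(L,d,[\ ,\ ])$ be the associated differential graded Lie algebra $C_>(\mathfrak g\oplus\mathfrak h,\mathfrak h)$. Then $$H^2_{nab}(\mathfrak g,\mathfrak h)\simeq \mathcal{MC}(L),$$ where $\mathcal{MC}(L)=MC(L)/\sim$ is the set of gauge equivalence classes of Maurer-Cartan elements of $L$ (the $\pi_0$ of the Deligne groupoid of $L$); the bijection is the one induced by $(\chi,\psi)\mapsto \chi+\psi$.
   Context: **Nonabelian cohomology.** A nonabelian 2-cocycle on $\mathfrak g$ with values in $\mathfrak h$ is a pair $(\chi,\psi)$ of linear maps $\chi:\mathfrak g\wedge\mathfrak g\to\mathfrak h$ and $\psi:\mathfrak g\to Der(\mathfrak h)$, $a\mapsto\psi_a$, such that for all $a,b,c\in\mathfrak g$: $[\psi_a,\psi_b]=\psi_{[a,b]}+ad_{\mathfrak h}(\chi(a\wedge b))$, and $\sum_{\circlearrowleft}\big(\psi_a\chi(b\wedge c)-\chi([a,b]\wedge c)\big)=0$ (sum over cyclic permutations of $a,b,c$). The set of these is $Z^2_{nab}(\mathfrak g,\mathfrak h)$. $H^2_{nab}(\mathfrak g,\mathfrak h)$ is the quotient of $Z^2_{nab}(\mathfrak g,\mathfrak h)$ by the equivalence relation: $(\chi,\psi)\sim(\chi',\psi')$ iff there is a linear map $\beta:\mathfrak g\to\mathfrak h$ with $\psi'_a=\psi_a+ad^{\mathfrak h}_{\beta(a)}$ and $\chi'(a\wedge b)=\chi(a\wedge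 b)+\psi_a\beta(b)-\psi_b\beta(a)-\beta([a,b])+[\beta(a),\beta(b)]$ for all $a,b\in\mathfrak g$. **Nijenhuis-Richardson bracket.** For a Lie algebra $\mathfrak l$ with bracket $\rho_{\mathfrak l}$, let $C^n(\mathfrak l,\mathfrak l)=\mathrm{Hom}(\wedge^n\mathfrak l,\mathfrak l)$, where an element of $C^{p+1}(\mathfrak l,\mathfrak l)$ has degree $p$. For $P$ of degree $p$ and $Q$ of degree $q$, $[P,Q]:=i_PQ-(-1)^{pq}i_QP$, with $i_PQ(l_0,\dots,l_{p+q}):=\sum_\sigma \mathrm{sign}(\sigma)\,Q(P(l_{\sigma(0)},\dots,l_{\sigma(p)}),l_{\sigma(p+1)},\dots,l_{\sigma(p+q)})$, sum over permutations $\sigma$ with $\sigma(0)<\dots<\sigma(p)$ and $\sigma(p+1)<\dots<\sigma(p+q)$. With $d:=[\rho_{\mathfrak l},\ ]$ this is a differential graded Lie algebra (dgLa). **The dgLa $L$.** Take $\mathfrak l=\mathfrak g\oplus\mathfrak h$ (direct sum of Lie algebras), so $d=[\rho_{\mathfrak g}+\rho_{\mathfrak h},\ ]$ with $\rho_{\mathfrak g},\rho_{\mathfrak h}$ the brackets of $\mathfrak g,\mathfrak h$. Using $\wedge^\bullet(\mathfrak g\oplus\mathfrak h)\simeq\wedge^\bullet\mathfrak g\otimes\wedge^\bullet\mathfrak h$, let $C^{m,n}=\mathrm{Hom}(\wedge^m\mathfrak g\otimes\wedge^n\mathfrak h,\mathfrak h)$, viewed inside $C^{m+n}(\mathfrak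 g\oplus\mathfrak h,\mathfrak g\oplus\mathfrak h)$, in degree $m+n-1$. Then $L=C_>(\mathfrak g\oplus\mathfrak h,\mathfrak h)=\bigoplus_{m\ge1,n\ge0}C^{m,n}$ is a sub-dgLa. Here $L^0=C^{1,0}=\mathrm{Hom}(\mathfrak g,\mathfrak h)$ and $L^1=C^{2,0}\oplus C^{1,1}$; $L^0$ is abelian and consists of ad-nilpotent elements. A pair $(\chi,\psi)$ is identified with $\chi+\psi\in L^1$, i.e. with the map $(g_1+h_1,g_2+h_2)\mapsto \chi(g_1,g_2)+\psi_{g_1}(h_2)-\psi_{g_2}(h_1)$. **Maurer-Cartan elements and gauge equivalence.** $MC(L)=\{\alpha\in L^1\mid d\alpha+\frac12[\alpha,\alpha]=0\}$. For $l,l'\in MC(L)$, $l\sim l'$ iff there is an ad-nilpotent $\beta\in L^0$ (for every $x\in L$ some power of $ad_\beta=[\beta,\ ]$ kills $x$) with $l'=e^{ad_\beta}l+g_\beta$, where $g_\beta:=-\sum_{n\ge0}\frac1{(n+1)!}ad_\beta^n(d\beta)$. This is an equivalence relation on $MC(L)$. *)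

(* Defs.v *)
From HB Require Import structures.
From mathcomp Require Import all_boot all_order all_algebra all_fingroup.
From mathcomp Require Import boolp classical_sets functions fsbigop.

Set Implicit Arguments.
Unset Strict Implicit.
Unset Printing Implicit Defensive.

Import GRing.Theory.

Local Open Scope classical_set_scope.
Local Open Scope ring_scope.

HB.mixin Record Lmodule_isLieAlgebra (K : fieldType) (V : Type)
    of GRing.Lmodule K V := {
  lie : V -> V -> V;
  lie_linearl : forall y, linear (fun x => lie x y);
  lie_linearr : forall x, linear (lie x);
  liexx : forall x, lie x x = 0;
  lie_jacobi : forall x y z,
    lie x (lie y z) + lie y (lie z x) + lie z (lie x y) = 0 }.

#[short(type="lieAlgType")]
HB.structure Definition LieAlgebra (K : fieldType) :=
  {V of GRing.Lmodule K V & Lmodule_isLieAlgebra K V}.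

Section DirectSum.
Variables (K : fieldType) (g h : lieAlgType K).

Definition dsum_lie (x y : g * h) : g * h := (lie x.1 y.1, lie x.2 y.2).

Fact dsum_lie_linearl y : linear (fun x => dsum_lie x y).
Proof.
by move=> a u v; rewrite /dsum_lie /= !lie_linearl.
Qed.

Fact dsum_lie_linearr x : linear (dsum_lie x).
Proof.
by move=> a u v; rewrite /dsum_lie /= !lie_linearr.
Qed.

Fact dsum_liexx x : dsum_lie x x = 0.
Proof. by rewrite /dsum_lie !liexx. Qed.

Fact dsum_lie_jacobi x y z :
  dsum_lie x (dsum_lie y z) + dsum_lie y (dsum_lie z x)
    + dsum_lie z (dsum_lie x y) = 0.
Proof. by congr pair; apply: lie_jacobi. Qed.

HB.instance Definition _ := Lmodule_isLieAlgebra.Build K (g * h)%type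
  dsum_lie_linearl dsum_lie_linearr dsum_liexx dsum_lie_jacobi.

End DirectSum.

(* The set of classes of elements of A under a relation R that is an
   equivalence relation on A. *)
Section Quotient.
Variables (T : Type) (A : set T) (R : T -> T -> Prop).

Definition eqclass (x : T) : set T := [set y | A y /\ R x y].
Definition quotient_set : set (set T) := eqclass @` A.

End Quotient.

Section NonabelianCohomology.
Variables (K : fieldType) (g h : lieAlgType K).

Definition derivation (D : h -> h) : Prop :=
  linear D /\ forall x y, D (lie x y) = lie (D x) y + lie x (D y).

(* A linear map out of the exterior square of g is an alternating bilinear
   map on g. *)
Record Z2nab (c : (g -> g -> h) * (g -> h -> h)) : Prop := {
  Z2nab_chi_linearl : forall b, linear (fun a => c.1 a b);
  Z2nab_chi_linearr : forall a, linear (c.1 a);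
  Z2nab_chi_alt : forall a, c.1 a a = 0;
  Z2nab_psi_der : forall a, derivation (c.2 a);
  Z2nab_psi_linear : forall x, linear (fun a => c.2 a x);
  Z2nab_curvature : forall a b x,
    c.2 a (c.2 b x) - c.2 b (c.2 a x) = c.2 (lie a b) x + lie (c.1 a b) x;
  Z2nab_cocycle : forall a b d,
    (c.2 a (c.1 b d) - c.1 (lie a b) d)
    + (c.2 b (c.1 d a) - c.1 (lie b d) a)
    + (c.2 d (c.1 a b) - c.1 (lie d a) b) = 0 }.

Definition nab_equiv (c c' : (g -> g -> h) * (g -> h -> h)) : Prop :=
  exists beta : g -> h,
    [/\ linear beta,
        forall a x, c'.2 a x = c.2 a x + lie (beta a) x &
        forall a b, c'.1 a b = c.1 a b + c.2 a (beta b) - c.2 b (beta a)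
                               - beta (lie a b) + lie (beta a) (beta b)].

Definition H2nab := quotient_set Z2nab nab_equiv.

End NonabelianCohomology.

(* C^n(l,l) = Hom(wedge^n l, l) is the subspace of those cochains that satisfy
   alt_multilinear below; its elements have degree n - 1. Arbitrary functions
   are used as the ambient type, with their pointwise vector space structure. *)
Notation cochain l n := ({ffun 'I_n -> l} -> l).

Section NijenhuisRichardson.
Variables (K : fieldType) (l : lieAlgType K).
Local Notation cochain n := (cochain l n).

Definition alt_multilinear n (F : cochain n) : Prop :=
  (forall (i : 'I_n) (v : {ffun 'I_n -> l}),
      linear (fun x : l => F [ffun j => if j == i then x else v j]))
  /\ (forall (v : {ffun 'I_n -> l}) (i j : 'I_n),
      i != j -> v i = v j -> F v = 0).

(* sigma(0) < ... < sigma(p) and sigma(p+1) < ... < sigma(n-1) *)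
Definition is_shuffle (p n : nat) (s : 'S_n) : bool :=
  [forall i : 'I_n, forall j : 'I_n,
    (i < j)%N && ((j <= p)%N || (p < i)%N) ==> (s i < s j)%N].

(* i_P Q. The result has r + 1 arguments, and r is always p + q: it is a
   separate parameter so that i_P Q and i_Q P have the same type. *)
Definition nr_insert p q r (P : cochain p.+1) (Q : cochain q.+1) :
    cochain r.+1 := fun v =>
  \sum_(s : 'S_r.+1 | is_shuffle p s)
    (-1) ^+ s *: Q [ffun j : 'I_q.+1 =>
      if j == ord0 then P [ffun i : 'I_p.+1 => v (s (inord i))]
      else v (s (inord (p + j)))].

Arguments nr_insert {p q} r P Q.

Definition nr_bracket p q (P : cochain p.+1) (Q : cochain q.+1) :
    cochain (p + q).+1 :=
  nr_insert (p + q) P Q - (-1) ^+ (p * q) *: nr_insert (p + q) Q P.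

Definition rho : cochain 2 := fun v => lie (v ord0) (v ord_max).

Definition nr_d q (Q : cochain q.+1) : cochain q.+2 := nr_bracket rho Q.

Definition nr_ad (beta : cochain 1) q (Q : cochain q.+1) : cochain q.+1 :=
  nr_bracket beta Q.

(* A graded subspace of the algebra above is given by its component L k in
   each degree k. *)
Section Deligne.
Variable L : forall k, set (cochain k.+1).

Definition MC : set (cochain 2) :=
  [set alpha : cochain 2 |
    @L 1 alpha /\ nr_d alpha + 2%:R^-1 *: @nr_bracket 1 1 alpha alpha = 0].

(* The direct sum of the L k. *)
Definition direct_sum : set (forall k, cochain k.+1) :=
  [set x | (forall k, @L k (x k)) /\
           exists N, forall k, (N <= k)%N -> x k = 0].

Definition ad_nilpotent (beta : cochain 1) : Prop :=
  forall x, direct_sum x ->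
    exists N, forall k, iter N (@nr_ad beta k) (x k) = 0.

(* The sums over all n are finite when beta is ad-nilpotent. *)
Definition exp_ad (beta : cochain 1) q (x : cochain q.+1) : cochain q.+1 :=
  \sum_(n \in [set: nat]) n`!%:R^-1 *: iter n (@nr_ad beta q) x.

Definition gauge_shift (beta : cochain 1) : cochain 2 :=
  - \sum_(n \in [set: nat])
      (n.+1)`!%:R^-1 *: iter n (@nr_ad beta 1) (nr_d beta).

Definition gauge_equiv (x x' : cochain 2) : Prop :=
  exists beta : cochain 1,
    [/\ @L 0 beta, ad_nilpotent beta &
        x' = exp_ad beta x + gauge_shift beta].

Definition MC_classes := quotient_set MC gauge_equiv.

End Deligne.

End NijenhuisRichardson.

Section TheDgla.
Variables (K : fieldType) (g h : lieAlgType K).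

(* C^{m,n-m} inside C^n(g+h, g+h): wedge^n(g+h) is the direct sum over m' of
   the spans of the wedges of m' vectors of g and n - m' vectors of h, and
   the elements of C^{m,n-m} are h-valued and zero on the summands with
   m' <> m. *)
Definition bihom (m n : nat) : set (cochain (g * h) n) :=
  [set F | [/\ alt_multilinear F,
               forall v, (F v).1 = 0 &
               forall (S : {set 'I_n}) (v : {ffun 'I_n -> g * h}),
                 (forall i, if i \in S then (v i).2 = 0 else (v i).1 = 0) ->
                 #|S| <> m -> F v = 0]].

(* Degree k component of C_>(g+h, h): the sum of the C^{m,n} with m >= 1 and
   m + n = k + 1. *)
Definition Cgt (k : nat) : set (cochain (g * h) k.+1) :=
  [set F | exists2 G : nat -> cochain (g * h) k.+1,
      forall m, (1 <= m <= k.+1)%N -> bihom m (G m) &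
      F = \sum_(1 <= m < k.+2) G m].

Definition cocycle_cochain (c : (g -> g -> h) * (g -> h -> h)) :
    cochain (g * h) 2 := fun v =>
  (* chi + psi *)
  let x := v ord0 in let y := v ord_max in
  (0, c.1 x.1 y.1 + c.2 x.1 y.2 - c.2 y.1 x.2).

End TheDgla.

(* Main.v *)
(** A map (chi, psi) is a nonabelian 2-cocycle exactly when rho + chi + psi is a
    Lie bracket on g + h: in degree 1, d alpha + [alpha, alpha] / 2 is the
    Jacobiator of rho + alpha, and its values on ggg, ggh and ghh are the
    cocycle condition, the curvature condition and the derivation property.
    For beta in L^0, [ad_beta] lowers by one the number of arguments in h that
    a cochain accepts, which gives ad-nilpotency and reduces the exponential
    series on L^1 to its first two terms; the gauge action of beta is then
    literally the formula defining the equivalence of nonabelian cocycles. *)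
Require Import Defs.
From HB Require Import structures.
From mathcomp Require Import all_boot all_order all_algebra all_fingroup.
From mathcomp Require Import boolp classical_sets functions fsbigop.

Set Implicit Arguments.
Unset Strict Implicit.
Unset Printing Implicit Defensive.

Import GRing.Theory.

Local Open Scope classical_set_scope.
Local Open Scope ring_scope.

(** * Decision of equalities in abelian groups by reflection *)

Inductive zmod_expr := ZVar of nat | ZZero
  | ZAdd of zmod_expr & zmod_expr | ZOpp of zmod_expr.

Fixpoint zmod_eval (V : zmodType) (env : seq V) (e : zmod_expr) : V :=
  match e with
  | ZVar i => env`_i
  | ZZero => 0
  | ZAdd e1 e2 => zmod_eval env e1 + zmod_eval env e2
  | ZOpp e1 => - zmod_eval env e1
  end.

(** The indices of the atoms with sign plus and with sign minus, counted with multiplicity. *)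
Fixpoint zmod_flat (e : zmod_expr) : seq nat * seq nat :=
  match e with
  | ZVar i => ([:: i], [::])
  | ZZero => ([::], [::])
  | ZAdd e1 e2 => let p1 := zmod_flat e1 in let p2 := zmod_flat e2 in
                  (p1.1 ++ p2.1, p1.2 ++ p2.2)
  | ZOpp e1 => let p := zmod_flat e1 in (p.2, p.1)
  end.

Lemma zmod_eval_flat (V : zmodType) (env : seq V) e :
  zmod_eval env e = \sum_(i <- (zmod_flat e).1) env`_i
                    - \sum_(i <- (zmod_flat e).2) env`_i.
Proof.
elim: e => [i||e1 IH1 e2 IH2|e IH] /=.
- by rewrite big_seq1 big_nil subr0.
- by rewrite !big_nil subr0.
- by rewrite IH1 IH2 !big_cat /= opprD addrACA.
- by rewrite IH opprB.
Qed.

(** Moving the negative atoms of each side to the other side leaves two sums without signs, so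
    comparing multisets of indices suffices and no cancellation has to be carried out. *)
Lemma zmod_reflect (V : zmodType) (env : seq V) e1 e2 :
  perm_eq ((zmod_flat e1).1 ++ (zmod_flat e2).2)
          ((zmod_flat e2).1 ++ (zmod_flat e1).2) ->
  zmod_eval env e1 = zmod_eval env e2.
Proof.
move=> perm_e12.
have E : \sum_(i <- (zmod_flat e1).1 ++ (zmod_flat e2).2) env`_i
       = \sum_(i <- (zmod_flat e2).1 ++ (zmod_flat e1).2) env`_i.
  exact: perm_big.
rewrite !big_cat /= in E; rewrite !zmod_eval_flat.
by apply/eqP; rewrite subr_eq addrAC eq_sym subr_eq eq_sym E.
Qed.

(* Atoms are compared up to conversion because the same term may carry
   different but convertible structure instances. *)
Ltac zmod_index x env :=
  match env with
  | ?y :: _ => let _ := match goal with _ => unify x y end in constr:(0%N)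
  | _ :: ?env' => let n := zmod_index x env' in constr:(n.+1)
  end.

Ltac zmod_atoms t env :=
  lazymatch t with
  | @GRing.add _ ?a ?b => let env' := zmod_atoms a env in zmod_atoms b env'
  | @GRing.opp _ ?a => zmod_atoms a env
  | @GRing.zero _ => env
  | _ => match env with
         | _ => let _ := zmod_index t env in env
         | _ => constr:(t :: env)
         end
  end.

Ltac zmod_reify t env :=
  lazymatch t with
  | @GRing.add _ ?a ?b =>
      let a' := zmod_reify a env in let b' := zmod_reify b env in
      constr:(ZAdd a' b')
  | @GRing.opp _ ?a => let a' := zmod_reify a env in constr:(ZOpp a')
  | @GRing.zero _ => constr:(ZZero)
  | _ => let n := zmod_index t env in constr:(ZVar n)
  end.

Ltac zmod :=
  lazymatch goal with
  | |- @eq ?V ?a ?b =>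
      let env := zmod_atoms a (@nil V) in
      let env := zmod_atoms b env in
      let a' := zmod_reify a env in
      let b' := zmod_reify b env in
      apply: (@zmod_reflect _ env a' b'); vm_compute; reflexivity
  end.

(** * Linear maps and Lie brackets *)

Section LinearMaps.
Variables (K : fieldType) (U V : lmodType K) (f : U -> V).
Hypothesis lin_f : linear f.

Lemma lin0 : f 0 = 0.
Proof. by have := lin_f (-1) 0 0; rewrite !scaleN1r !addNr. Qed.

Lemma linD x y : f (x + y) = f x + f y.
Proof. by have := lin_f 1 x y; rewrite !scale1r. Qed.

Lemma linZ a x : f (a *: x) = a *: f x.
Proof. by have := lin_f a x 0; rewrite lin0 !addr0. Qed.

Lemma linN x : f (- x) = - f x.
Proof. by rewrite -scaleN1r linZ scaleN1r. Qed.

End LinearMaps.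

Lemma alternating_anti (K : fieldType) (U V : lmodType K) (f : U -> U -> V) :
    (forall y, linear (f^~ y)) -> (forall x, linear (f x)) ->
    (forall x, f x x = 0) ->
  forall x y, f x y = - f y x.
Proof.
move=> fl fr alt x y; have := alt (x + y).
rewrite (linD (fl _)) !(linD (fr _)) !alt add0r addr0 => /eqP.
by rewrite addr_eq0 => /eqP.
Qed.

Lemma lieC (K : fieldType) (l : lieAlgType K) (x y : l) : lie x y = - lie y x.
Proof.
by apply: alternating_anti => *;
  [exact: lie_linearl|exact: lie_linearr|exact: liexx].
Qed.

Lemma lie0l (K : fieldType) (l : lieAlgType K) (x : l) : lie 0 x = 0.
Proof. exact: (lin0 (@lie_linearl _ _ x)). Qed.

Lemma lie0r (K : fieldType) (l : lieAlgType K) (x : l) : lie x 0 = 0.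
Proof. exact: (lin0 (@lie_linearr _ _ x)). Qed.

Lemma dsum_lieE (K : fieldType) (g h : lieAlgType K) (x y : g * h) :
  lie x y = (lie x.1 y.1, lie x.2 y.2).
Proof. by []. Qed.

(** * Shuffles of two and three arguments *)

Lemma shuffle_ltn p n (s : 'S_n) (i j : 'I_n) :
  is_shuffle p s -> (i < j)%N -> (j <= p)%N || (p < i)%N -> (s i < s j)%N.
Proof.
move=> /forallP/(_ i)/forallP/(_ j)/implyP sP ij pij.
by apply: sP; rewrite ij.
Qed.

Lemma ord2P (i : 'I_2) : {i = ord0} + {i = ord_max}.
Proof.
case: i => [[|[|//]] ilt]; [left|right]; exact: val_inj.
Qed.

Definition ord_mid : 'I_3 := Ordinal (isT : (1 < 3)%N).

Lemma ord3P (i : 'I_3) : [\/ i = ord0, i = ord_mid | i = ord_max].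
Proof.
case: i => [[|[|[|//]]] ilt];
  [constructor 1|constructor 2|constructor 3]; exact: val_inj.
Qed.

(** Used to evaluate a sum over shuffles by listing them. *)
Lemma big_pred_seq (V : zmodType) (T : finType) (P : pred T) (r : seq T)
    (F : T -> V) :
  uniq r -> P =i r -> \sum_(s | P s) F s = \sum_(s <- r) F s.
Proof.
by move=> ur Pr; rewrite big_uniq //; apply: eq_bigl => s; exact: Pr.
Qed.

Lemma perm2_eq (s t : 'S_2) : s ord0 = t ord0 -> s = t.
Proof.
move=> st0; apply/permP => i; case: (ord2P i) => -> //.
have: s ord_max != s ord0 by rewrite (inj_eq perm_inj).
have: t ord_max != t ord0 by rewrite (inj_eq perm_inj).
rewrite st0; case: (ord2P (s ord_max)) (ord2P (t ord_max)) (ord2P (t ord0));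
  by move=> -> [] -> [] ->.
Qed.

Lemma perm3_eq (s t : 'S_3) :
  s ord0 = t ord0 -> s ord_mid = t ord_mid -> s = t.
Proof.
move=> st0 st1; apply/permP => i; case: (ord3P i) => -> //.
have: t ord_mid != t ord0 by rewrite (inj_eq perm_inj).
have: s ord_max != s ord0 by rewrite (inj_eq perm_inj).
have: t ord_max != t ord0 by rewrite (inj_eq perm_inj).
have: s ord_max != s ord_mid by rewrite (inj_eq perm_inj).
have: t ord_max != t ord_mid by rewrite (inj_eq perm_inj).
rewrite st0 st1.
case: (ord3P (s ord_max)) (ord3P (t ord_max));
  case: (ord3P (t ord0)) (ord3P (t ord_mid));
  by move=> -> [] -> -> [] ->.
Qed.

(** The cycle 0 -> 1 -> 2 -> 0, written as a product of two transpositions so that its sign can be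
    read off. *)
Definition rot3 : 'S_3 := (tperm ord0 ord_mid * tperm ord0 ord_max)%g.

Lemma rot3E :
  [/\ rot3 ord0 = ord_mid, rot3 ord_mid = ord_max & rot3 ord_max = ord0].
Proof.
split; rewrite permM.
- by rewrite tpermL tpermD.
- by rewrite tpermR tpermL.
- by rewrite [tperm ord0 ord_mid _]tpermD // tpermR.
Qed.

(** Both blocks have one element, so the monotonicity condition is vacuous. *)
Lemma sum_shuffle_0_2 (V : zmodType) (F : 'S_2 -> V) :
  \sum_(s | is_shuffle 0 s) F s = F 1%g + F (tperm ord0 ord_max).
Proof.
rewrite (@big_pred_seq _ _ _ [:: 1%g; tperm ord0 ord_max]);
  first by rewrite !big_cons big_nil addr0.
  by rewrite /= inE andbT; apply/eqP => /permP/(_ ord0); rewrite perm1 tpermL.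
move=> s; rewrite !inE; transitivity true.
  apply/forallP => i; apply/forallP => j.
  by case: (ord2P i) (ord2P j) => -> [] ->.
case: (ord2P (s ord0)) => s0; apply/esym/orP; [left|right];
  apply/eqP; apply: perm2_eq.
  by rewrite perm1.
by rewrite tpermL.
Qed.

Lemma sum_shuffle_1_2 (V : zmodType) (F : 'S_2 -> V) :
  \sum_(s | is_shuffle 1 s) F s = F 1%g.
Proof.
rewrite (@big_pred_seq _ _ _ [:: 1%g]) ?big_cons ?big_nil ?addr0 //.
move=> s; rewrite !inE; apply/idP/eqP => [ss|->].
  apply: perm2_eq; rewrite perm1.
  have := @shuffle_ltn 1 2 s ord0 ord_max ss isT isT.
  by case: (ord2P (s ord0)) (ord2P (s ord_max)) => -> [] ->.
apply/forallP => i; apply/forallP => j; rewrite !perm1.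
by case: (ord2P i) (ord2P j) => -> [] ->.
Qed.

(** Since [s ord0 < s ord_mid], a shuffle is determined by the value at [ord_max]: 2, 1 and 0 for
    the three terms in this order. *)
Lemma sum_shuffle_1_3 (V : zmodType) (F : 'S_3 -> V) :
  \sum_(s | is_shuffle 1 s) F s = F 1%g + F (tperm ord_mid ord_max) + F rot3.
Proof.
have t0 : tperm ord_mid ord_max ord0 = ord0 :> 'I_3 by rewrite tpermD.
have [r0 r1 r2] := rot3E.
rewrite (@big_pred_seq _ _ _ [:: 1%g; tperm ord_mid ord_max; rot3]).
- by rewrite !big_cons big_nil addr0 addrA.
- rewrite /= !inE !andbT; apply/andP; split; [apply/norP; split|];
    apply/eqP => /permP.
  + by move=> /(_ ord_mid); rewrite perm1 tpermL.
  + by move=> /(_ ord0); rewrite perm1 r0.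
  + by move=> /(_ ord0); rewrite t0 r0.
move=> s; rewrite !inE; apply/idP/idP => [ss|/or3P[]/eqP->].
- have := @shuffle_ltn 1 3 s ord0 ord_mid ss isT isT.
  case: (ord3P (s ord0)) (ord3P (s ord_mid)) => s0 [] s1; rewrite s0 s1 // => _;
    apply/or3P; [constructor 1|constructor 2|constructor 3]; apply/eqP;
    apply: perm3_eq; by rewrite ?perm1 ?r0 ?r1 ?t0 ?tpermL.
- apply/forallP => i; apply/forallP => j; rewrite !perm1.
  by case: (ord3P i) (ord3P j) => -> [] ->.
- apply/forallP => i; apply/forallP => j.
  by case: (ord3P i) (ord3P j) => -> [] ->; rewrite ?t0 ?tpermL ?tpermR.
- apply/forallP => i; apply/forallP => j.
  by case: (ord3P i) (ord3P j) => -> [] ->; rewrite ?r0 ?r1 ?r2.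
Qed.

(** * Insertions in low degree *)

Definition vec2 (T : Type) (x y : T) : {ffun 'I_2 -> T} :=
  [ffun i => if i == ord0 then x else y].

Lemma vec2E (T : Type) (v : {ffun 'I_2 -> T}) : v = vec2 (v ord0) (v ord_max).
Proof. by apply/ffunP => i; rewrite ffunE; case: (ord2P i) => ->. Qed.

Lemma vec2P (T : Type) (v : {ffun 'I_2 -> T}) x y :
  v ord0 = x -> v ord_max = y -> v = vec2 x y.
Proof. by move=> <- <-; exact: vec2E. Qed.

Lemma ffun3E (T : Type) (x y z : T) : exists v : {ffun 'I_3 -> T},
  [/\ v ord0 = x, v ord_mid = y & v ord_max = z].
Proof. by exists [ffun i : 'I_3 => nth x [:: x; y; z] i]; rewrite !ffunE. Qed.

Section SmallInsertions.
Variables (K : fieldType) (l : lieAlgType K).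

Definition const1 (x : l) : {ffun 'I_1 -> l} := [ffun=> x].

Lemma nr_insert_0_1 (P : cochain l 1) (Q : cochain l 2) v :
  @nr_insert K l 0 1 1 P Q v =
  Q (vec2 (P (const1 (v ord0))) (v ord_max))
  - Q (vec2 (P (const1 (v ord_max))) (v ord0)).
Proof.
rewrite /nr_insert sum_shuffle_0_2 odd_perm1 odd_tperm /= expr0 expr1.
rewrite scale1r scaleN1r.
congr (Q _ - Q _); apply/ffunP => j; rewrite !ffunE; case: (ord2P j) => -> /=.
- congr P; apply/ffunP => i; rewrite !ffunE perm1; congr (v _).
  by apply: val_inj; rewrite /= inordK //; case: i => -[].
- by rewrite perm1; congr (v _); apply: val_inj; rewrite /= inordK.
- congr P; apply/ffunP => i; rewrite !ffunE (_ : inord i = ord0) ?tpermL //.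
  by apply: val_inj; rewrite /= inordK //; case: i => -[].
- rewrite (_ : inord _ = ord_max) ?tpermR //.
  by apply: val_inj; rewrite /= inordK.
Qed.

Lemma nr_insert_1_0 (P : cochain l 2) (Q : cochain l 1) v :
  @nr_insert K l 1 0 1 P Q v = Q (const1 (P v)).
Proof.
rewrite /nr_insert sum_shuffle_1_2 odd_perm1 expr0 scale1r.
congr Q; apply/ffunP => j; rewrite !ffunE (ord1 j) /=.
congr P; apply/ffunP => i; rewrite !ffunE perm1; congr (v _).
by apply: val_inj; rewrite /= inordK.
Qed.

(** The signs are those of the identity, a transposition and a 3-cycle. For P = Q = [rho] this is
    the Jacobiator of the bracket. *)
Lemma nr_insert_1_1 (P Q : cochain l 2) v :
  @nr_insert K l 1 1 2 P Q v =
  Q (vec2 (P (vec2 (v ord0) (v ord_mid))) (v ord_max))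
  - Q (vec2 (P (vec2 (v ord0) (v ord_max))) (v ord_mid))
  + Q (vec2 (P (vec2 (v ord_mid) (v ord_max))) (v ord0)).
Proof.
rewrite /nr_insert sum_shuffle_1_3 odd_perm1 odd_permM !odd_tperm /=.
rewrite expr0 expr1 !scale1r scaleN1r.
have i0 : inord 0 = ord0 :> 'I_3 by apply: val_inj; rewrite /= inordK.
have i1 : inord 1 = ord_mid :> 'I_3 by apply: val_inj; rewrite /= inordK.
have i2 : inord 2 = ord_max :> 'I_3 by apply: val_inj; rewrite /= inordK.
have t0 : tperm ord_mid ord_max ord0 = ord0 :> 'I_3 by rewrite tpermD.
have [r0 r1 r2] := rot3E.
congr (Q _ - Q _ + Q _); apply: vec2P; rewrite !ffunE /=.
- by congr P; apply: vec2P; rewrite !ffunE /= ?i0 ?i1 perm1.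
- by rewrite i2 perm1.
- by congr P; apply: vec2P; rewrite !ffunE /= ?i0 ?i1 ?t0 ?tpermL.
- by rewrite i2 tpermR.
- by congr P; apply: vec2P; rewrite !ffunE /= ?i0 ?i1 ?r0 ?r1.
- by rewrite i2 r2.
Qed.

End SmallInsertions.

(** * Maurer-Cartan elements *)

Section MaurerCartan.
Variables (K : fieldType) (g h : lieAlgType K).
Implicit Types c : (g -> g -> h) * (g -> h -> h).

(** The linear part of [Z2nab]. It expresses that chi + psi lies in L^1 ([precocycle_Cgt], [Cgt1P]),
    and the remaining conditions of [Z2nab] are then equivalent to the Maurer-Cartan equation. *)
Record precocycle c : Prop := {
  pre_chil : forall b, linear (fun a => c.1 a b);
  pre_chir : forall a, linear (c.1 a);
  pre_chi_alt : forall a, c.1 a a = 0;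
  pre_psir : forall a, linear (c.2 a);
  pre_psil : forall x, linear (fun a => c.2 a x) }.

Lemma Z2nab_precocycle c : Z2nab c -> precocycle c.
Proof. by case=> chil chir alt der psil _ _; split=> // a; case: (der a). Qed.

(** The h-component of [[x, y], z] for the bracket [rho] + chi + psi, without the term [[x.2, y.2],
    z.2], which comes from [rho] alone. *)
Definition jacobi_term c (x y z : g * h) : h :=
  c.1 (lie x.1 y.1) z.1 + c.2 (lie x.1 y.1) z.2 - c.2 z.1 (lie x.2 y.2)
  + lie (c.1 x.1 y.1 + c.2 x.1 y.2 - c.2 y.1 x.2) z.2
  - c.2 z.1 (c.1 x.1 y.1 + c.2 x.1 y.2 - c.2 y.1 x.2).

(** In degree 1 the sign -(-1)^(pq) is +1, so the bracket is symmetric and [alpha, alpha] is twice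
    the insertion of alpha into itself. *)
Lemma MC_equationE (l : lieAlgType K) (alpha : cochain l 2) : 2%:R != 0 :> K ->
  nr_d alpha + 2%:R^-1 *: @nr_bracket K l 1 1 alpha alpha =
  @nr_insert K l 1 1 2 (@rho K l) alpha + @nr_insert K l 1 1 2 alpha (@rho K l)
  + @nr_insert K l 1 1 2 alpha alpha.
Proof.
move=> nz2; rewrite /nr_d /nr_bracket expr1 !scaleN1r !opprK; congr (_ + _).
by rewrite -mulr2n -scaler_nat scalerA mulVf // scale1r.
Qed.

Lemma MC_cocycleE c v : precocycle c ->
  let alpha := cocycle_cochain c in
  let ins := @nr_insert K (g * h)%type 1 1 2 in
  (ins (@rho K _) alpha + ins alpha (@rho K _) + ins alpha alpha) v =
  (0, jacobi_term c (v ord0) (v ord_mid) (v ord_max)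
      - jacobi_term c (v ord0) (v ord_max) (v ord_mid)
      + jacobi_term c (v ord_mid) (v ord_max) (v ord0)).
Proof.
move=> [chil chir alt psir psil] /=.
rewrite !fctE !nr_insert_1_1 /rho /cocycle_cochain !ffunE /=.
rewrite !dsum_lieE /=.
rewrite !lie0l !(lin0 (chil _)) !(lin0 (psil _)).
rewrite /jacobi_term; apply/pair_eqP; apply/andP; split; apply/eqP => /=; zmod.
Qed.

Lemma MC_cocycle_jacobi c : 2%:R != 0 :> K -> precocycle c ->
  (nr_d (cocycle_cochain c)
   + 2%:R^-1 *: @nr_bracket K _ 1 1 (cocycle_cochain c) (cocycle_cochain c) = 0)
  <-> forall x y z,
    jacobi_term c x y z - jacobi_term c x z y + jacobi_term c y z x = 0.
Proof.
move=> nz2 pre_c; rewrite MC_equationE //; split=> [E x y z|E].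
  have [v [vx vy vz]] := ffun3E x y z.
  by have := MC_cocycleE v pre_c; rewrite /= E vx vy vz => /(congr1 snd).
by apply/funext => v; rewrite (MC_cocycleE v pre_c) E.
Qed.

(** The derivation rule expands psi of a bracket and the curvature identity eliminates the brackets
    with chi. What remains is minus the cocycle identity at the g-components. *)
Lemma Z2nab_jacobi c : Z2nab c -> forall x y z,
  jacobi_term c x y z - jacobi_term c x z y + jacobi_term c y z x = 0.
Proof.
case=> chil chir alt der psil curv coc x y z.
have psir a : linear (c.2 a) by case: (der a).
have derE a u v : c.2 a (lie u v) = lie (c.2 a u) v + lie u (c.2 a v).
  by case: (der a).
have curvE a b u : lie (c.1 a b) u =
    c.2 a (c.2 b u) - c.2 b (c.2 a u) - c.2 (lie a b) u.
  by rewrite curv; zmod.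
have chiC := alternating_anti chil chir alt.
(* The cyclic sum is brought to the argument order of the three shuffles. *)
have := coc x.1 y.1 z.1; rewrite (chiC z.1 x.1) (lieC z.1 x.1).
rewrite (linN (psir _)) (linN (chil _)) => coc0.
rewrite -[RHS]oppr0 -coc0 /jacobi_term !derE.
rewrite !(linD (lie_linearl _), linN (lie_linearl _)).
rewrite !(linD (psir _), linN (psir _)).
rewrite !curvE.
rewrite !(lieC x.2 (c.2 _ _)) !(lieC y.2 (c.2 _ _)); zmod.
Qed.

Lemma jacobi_Z2nab c : precocycle c ->
  (forall x y z,
    jacobi_term c x y z - jacobi_term c x z y + jacobi_term c y z x = 0) ->
  Z2nab c.
Proof.
case=> chil chir alt psir psil jac.
have chi0l b : c.1 0 b = 0 := lin0 (chil b).
have psi0l x : c.2 0 x = 0 := lin0 (psil x).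
have chi0r a : c.1 a 0 = 0 := lin0 (chir a).
have psi0r a : c.2 a 0 = 0 := lin0 (psir a).
have chiC := alternating_anti chil chir alt.
have simp := (lie0l, lie0r, chi0l, chi0r, psi0l, psi0r,
  add0r, addr0, oppr0, subr0, sub0r).
split=> //.
- move=> a; split=> // x y; have := jac (a, 0) (0, x) (0, y).
  rewrite /jacobi_term /= !simp (lieC (c.2 a y)) => E.
  by apply: subr0_eq; rewrite -[RHS]oppr0 -E; zmod.
- move=> a b x; have := jac (a, 0) (b, 0) (0, x).
  rewrite /jacobi_term /= !simp => E.
  by apply: subr0_eq; rewrite -[RHS]oppr0 -E; zmod.
- move=> a b d; have := jac (a, 0) (b, 0) (d, 0).
  rewrite /jacobi_term /= !simp => E.
  rewrite (chiC d a) (lieC d a) (linN (psir _)) (linN (chil _)).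
  by rewrite -[RHS]oppr0 -E; zmod.
Qed.

Lemma Z2nab_iff c : 2%:R != 0 :> K ->
  Z2nab c <-> precocycle c /\
  nr_d (cocycle_cochain c)
   + 2%:R^-1 *: @nr_bracket K _ 1 1 (cocycle_cochain c) (cocycle_cochain c) = 0.
Proof.
move=> nz2; split=> [Zc|[pre_c]].
  have pre_c := Z2nab_precocycle Zc; split=> //.
  by apply/MC_cocycle_jacobi => //; exact: Z2nab_jacobi.
by move=> /(MC_cocycle_jacobi nz2 pre_c); exact: jacobi_Z2nab.
Qed.

End MaurerCartan.

(** * Components of degree 0 and 1 *)

Section LowDegrees.
Variables (K : fieldType) (g h : lieAlgType K).
Implicit Types c : (g -> g -> h) * (g -> h -> h).

Lemma snd0_eq (u : g * h) : u.1 = 0 -> u = (0, u.2).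
Proof. by case: u => ? ? /= ->. Qed.

Lemma inl_lin (a : K) (u v : g) :
  (a *: u + v, 0) = a *: (u, 0) + (v, 0) :> g * h.
Proof. by congr pair; rewrite /= scaler0 addr0. Qed.

Lemma inr_lin (a : K) (u v : h) :
  (0, a *: u + v) = a *: (0, u) + (0, v) :> g * h.
Proof. by congr pair; rewrite /= scaler0 addr0. Qed.

Lemma cocycle_cochain_alt c :
  precocycle c -> alt_multilinear (cocycle_cochain c).
Proof.
case=> chil chir alt psir psil; split=> [i v a u w|v i j ij vij].
  rewrite /cocycle_cochain !ffunE; case: (ord2P i) => -> /=;
    rewrite -inr_lin; congr pair.
  - rewrite chil psil psir !scalerDr scalerN; zmod.
  - rewrite chir psil psir !scalerDr scalerN; zmod.
have v01 : v ord0 = v ord_max.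
  by move: ij vij; case: (ord2P i) (ord2P j) => -> [] ->.
by rewrite /cocycle_cochain v01 alt add0r subrr.
Qed.

Lemma card_set_ord2 (S : {set 'I_2}) :
  #|S| = ((ord0 \in S) + (ord_max \in S))%N.
Proof.
rewrite -sum1_card big_mkcond big_ord_recl big_ord1 /=.
by rewrite (_ : lift ord0 ord0 = ord_max) //; exact: val_inj.
Qed.

Lemma precocycle_bihom1 c : precocycle c ->
  bihom 1 (cocycle_cochain (fun _ _ => 0, c.2) : cochain (g * h) 2).
Proof.
case=> chil chir alt psir psil.
split=> // [|S v vS S1]; first apply: cocycle_cochain_alt; first split=> //=.
- by move=> b a u w; rewrite scaler0 addr0.
- by move=> a b u w; rewrite scaler0 addr0.
have psi0l x : c.2 0 x = 0 := lin0 (psil x).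
have psi0r a : c.2 a 0 = 0 := lin0 (psir a).
rewrite /cocycle_cochain /= add0r.
have := vS ord0; have := vS ord_max; move: S1; rewrite card_set_ord2.
by case: (ord0 \in S) (ord_max \in S) => [] [] // _ -> ->;
  rewrite ?psi0l ?psi0r subrr.
Qed.

Lemma precocycle_bihom2 c : precocycle c ->
  bihom 2 (cocycle_cochain (c.1, fun _ _ => 0) : cochain (g * h) 2).
Proof.
case=> chil chir alt psir psil.
split=> // [|S v vS S2]; first apply: cocycle_cochain_alt; first split=> //=.
- by move=> a u w x; rewrite scaler0 addr0.
- by move=> a u w x; rewrite scaler0 addr0.
have chi0l b : c.1 0 b = 0 := lin0 (chil b).
have chi0r b : c.1 b 0 = 0 := lin0 (chir b).
rewrite /cocycle_cochain /= subr0 addr0.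
have := vS ord0; have := vS ord_max; move: S2; rewrite card_set_ord2.
by case: (ord0 \in S) (ord_max \in S) => [] [] // _ E1 E2;
  rewrite ?E1 ?E2 ?chi0l ?chi0r.
Qed.

Lemma precocycle_Cgt c : precocycle c -> Cgt (cocycle_cochain c).
Proof.
move=> pre_c.
(* The part psi lies in C^{1,1} and the part chi in C^{2,0}. *)
exists (fun m => if m == 1%N then cocycle_cochain (fun _ _ => 0, c.2)
                 else cocycle_cochain (c.1, fun _ _ => 0)).
  by case=> [|[|[|]]] //= _;
    [exact: precocycle_bihom1|exact: precocycle_bihom2].
rewrite big_ltn // big_ltn // big_geq // addr0 /=; apply/funext => v.
by rewrite /cocycle_cochain !fctE /=; congr pair; rewrite ?addr0 //=; zmod.
Qed.

Lemma linear_snd_vec2l (F : cochain (g * h) 2) : alt_multilinear F ->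
  forall y, linear (fun x => (F (vec2 x y)).2).
Proof.
move=> [Fl _] y a u w; have := Fl ord0 (vec2 0 y) a u w.
have E x : [ffun j => if j == ord0 then x else vec2 0 y j] = vec2 x y.
  by apply: vec2P; rewrite !ffunE.
by rewrite !E => ->.
Qed.

Lemma linear_snd_vec2r (F : cochain (g * h) 2) : alt_multilinear F ->
  forall x, linear (fun y => (F (vec2 x y)).2).
Proof.
move=> [Fl _] x a u w; have := Fl ord_max (vec2 x 0) a u w.
have E y : [ffun j => if j == ord_max then y else vec2 x 0 j] = vec2 x y.
  by apply: vec2P; rewrite !ffunE.
by rewrite !E => ->.
Qed.

Definition cochain_pair (F : cochain (g * h) 2) :
    (g -> g -> h) * (g -> h -> h) :=
  (fun a b => (F (vec2 (a, 0) (b, 0))).2,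
   fun a x => (F (vec2 (a, 0) (0, x))).2).

(** Bilinearity splits F into four blocks. The h-h block vanishes by assumption, and antisymmetry
    turns the h-g block into minus the g-h block, which gives the two psi terms. *)
Lemma cochain_pairP (F : cochain (g * h) 2) :
    alt_multilinear F -> (forall v, (F v).1 = 0) ->
    (forall x y, F (vec2 (0, x) (0, y)) = 0) ->
  precocycle (cochain_pair F) /\ F = cocycle_cochain (cochain_pair F).
Proof.
move=> Falt F1 Fh.
have Fl := linear_snd_vec2l Falt; have Fr := linear_snd_vec2r Falt.
have Fxx x : (F (vec2 x x)).2 = 0.
  by rewrite (Falt.2 (vec2 x x) ord0 ord_max) // !ffunE.
have FC := alternating_anti Fl Fr Fxx.
split.
  split=> //= [b a u w|a b u w|a b u w|x a u w]; rewrite ?inl_lin ?inr_lin.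
  - exact: (Fl (b, 0)).
  - exact: (Fr (a, 0)).
  - exact: (Fr (a, 0)).
  - exact: (Fl (0, x)).
apply/funext => v; rewrite [LHS]snd0_eq // /cocycle_cochain /=; congr pair.
rewrite {1}(vec2E v); case: (v ord0) (v ord_max) => [a x] [b y] /=.
have split_pair (p : g) (q : h) : (p, q) = (p, 0) + (0, q).
  by congr pair; rewrite /= ?addr0 ?add0r.
rewrite (split_pair a x) (split_pair b y) (linD (Fl _)) !(linD (Fr _)) Fh /=.
by rewrite (FC (0, x)); zmod.
Qed.

Lemma alt_multilinearD (l : lieAlgType K) n (F G : cochain l n) :
  alt_multilinear F -> alt_multilinear G -> alt_multilinear (F + G).
Proof.
move=> [Fl Fa] [Gl Ga]; split=> [i v a u w|v i j ij vij]; rewrite !fctE.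
  by rewrite Fl Gl scalerDr; zmod.
by rewrite (Fa _ i j) // (Ga _ i j) // addr0.
Qed.

Lemma Cgt1P (F : cochain (g * h) 2) :
  Cgt F -> exists2 c, precocycle c & F = cocycle_cochain c.
Proof.
move=> [G Gbi ->]; rewrite big_ltn // big_ltn // big_geq // addr0.
have [G1l G1h G1S] := Gbi 1%N isT; have [G2l G2h G2S] := Gbi 2%N isT.
have [] := @cochain_pairP (G 1%N + G 2%N);
  last by exists (cochain_pair (G 1%N + G 2%N)).
- exact: alt_multilinearD.
- by move=> v; rewrite fctE /= G1h G2h addr0.
(* Two vectors of h correspond to the empty set of g-slots, whose cardinal is neither 1 nor 2. *)
- move=> x y; rewrite fctE (G1S finset.set0) ?(G2S finset.set0) ?addr0;
    rewrite ?cards0 //;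
    by move=> i; rewrite inE !ffunE; case: ifP.
Qed.

Definition hom_cochain (b : g -> h) : cochain (g * h) 1 :=
  fun v => (0, b (v ord0).1).

Lemma Cgt0P (F : cochain (g * h) 1) :
  Cgt F <-> exists2 b, linear b & F = hom_cochain b.
Proof.
split=> [[G Gbi ->]|[b blin ->]].
  rewrite big_ltn // big_geq // addr0; have [[Gl _] Gh GS] := Gbi 1%N isT.
  have lin1 : linear (fun x => (G 1%N (const1 x)).2).
    move=> a u w; have := Gl ord0 (const1 0) a u w.
    have E x : [ffun j => if j == ord0 then x else const1 0 j] = const1 x
      :> {ffun 'I_1 -> g * h}.
      by apply/ffunP => j; rewrite !ffunE (ord1 j).
    by rewrite !E => ->.
  exists (fun a => (G 1%N (const1 (a, 0))).2) => [a u w|].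
    by rewrite inl_lin; exact: lin1.
  apply/funext => v; rewrite [LHS]snd0_eq // /hom_cochain; congr pair.
  have -> : v = const1 (v ord0) by apply/ffunP => j; rewrite !ffunE (ord1 j).
  rewrite ffunE; case: (v ord0) => a x /=.
  rewrite -[in LHS](addr0 a) -[in LHS](add0r x).
  rewrite -[(a + 0, 0 + x)]/((a, 0) + (0, x)) (linD lin1).
  (* An element of C^{1,0} vanishes on h, so only the g-component of the argument counts. *)
  rewrite [G 1%N (const1 (0, x))](GS finset.set0) ?cards0 ?addr0 // => i.
  by rewrite inE ffunE.
exists (fun=> hom_cochain b); last by rewrite big_ltn // big_geq // addr0.
case=> [|[|]] // _; split=> // [|S v vS S1].
  split=> [i v a u w|v i j]; last by rewrite (ord1 i) (ord1 j).
  rewrite /hom_cochain !ffunE (ord1 i) eqxx -inr_lin.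
  by congr pair; rewrite blin.
have := vS ord0; rewrite /hom_cochain; case: ifPn => [S0 _|_ ->].
  case: S1; rewrite -[RHS](card_ord 1); apply: eq_card => i.
  by rewrite (ord1 i) S0.
by rewrite (lin0 blin).
Qed.

(** Assuming only vanishing at zero lets this apply to [gauge_pair b c] without proving that it is a
    precocycle. *)
Lemma cocycle_cochain_inj c c' :
  (forall a, c.1 a 0 = 0) -> (forall a, c.2 a 0 = 0) ->
  (forall x, c.2 0 x = 0) ->
  (forall a, c'.1 a 0 = 0) -> (forall a, c'.2 a 0 = 0) ->
  (forall x, c'.2 0 x = 0) ->
  cocycle_cochain c = cocycle_cochain c' -> c = c'.
Proof.
case: c c' => [chi psi] [chi' psi'] /= c0 p0r p0l c0' p0r' p0l' E.
have {}E x y := congr1 (fun F => (F (vec2 x y)).2) E.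
congr pair; apply/funext => a; apply/funext => x.
  have := E (a, 0) (x, 0).
  by rewrite /cocycle_cochain /= !ffunE /= !p0r !p0r' !subr0 !addr0.
have := E (a, 0) (0, x).
by rewrite /cocycle_cochain /= !ffunE /= c0 c0' p0l p0l' !subr0 !add0r.
Qed.

End LowDegrees.

(** * Gauge action *)

Section Gauge.
Variables (K : fieldType) (g h : lieAlgType K) (b : g -> h).
Hypothesis lin_b : linear b.
Implicit Types c : (g -> g -> h) * (g -> h -> h).

(** The filtration by the number of arguments in h. Level 0 forces Q = 0, through the empty S.
    Vanishing at a zero argument stands in for multilinearity and is easily seen to pass to
    [nr_ad]. *)
Definition h_filtered (m k : nat) (Q : cochain (g * h) k.+1) : Prop :=
  [/\ forall v, (Q v).1 = 0,
      forall (v : {ffun 'I_k.+1 -> g * h}) i, v i = 0 -> Q v = 0 &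
      forall (v : {ffun 'I_k.+1 -> g * h}) (S : {set 'I_k.+1}), (m <= #|S|)%N ->
        {in S, forall i, (v i).1 = 0} -> Q v = 0].

Lemma nr_adE k (Q : cochain (g * h) k.+1) v :
  nr_ad (hom_cochain b) Q v =
  \sum_(s : 'S_k.+1 | is_shuffle 0 s) (-1) ^+ s *: Q [ffun j =>
    if j == ord0 then hom_cochain b (const1 (v (s ord0))) else v (s j)]
  - \sum_(s : 'S_k.+1 | is_shuffle k s) (-1) ^+ s *:
      hom_cochain b (const1 (Q [ffun i => v (s i)])).
Proof.
rewrite /nr_ad /nr_bracket /= mul0n expr0 scale1r; congr (_ - _).
  apply: eq_bigr => s _; congr (_ *: Q _); apply/ffunP => j; rewrite !ffunE.
  case: ifP => _; last by congr (v (s _)); exact: inord_val.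
  rewrite /hom_cochain !ffunE (_ : inord _ = ord0) //.
  by apply: val_inj; rewrite /= inordK.
apply: eq_bigr => s _; congr (_ *: _); rewrite /hom_cochain !ffunE /=.
by congr (0, b (Q _).1); apply/ffunP => i; rewrite !ffunE inord_val.
Qed.

(* A vector of h killed by b contributes 0, so each surviving term of ad_b Q
   replaces a vector outside h by one in h. *)
Lemma h_filtered_ad m k (Q : cochain (g * h) k.+1) :
  h_filtered m Q -> h_filtered m.-1 (nr_ad (hom_cochain b) Q).
Proof.
move=> [Qh Q0 QS].
have adE v : nr_ad (hom_cochain b) Q v =
    \sum_(s : 'S_k.+1 | is_shuffle 0 s) (-1) ^+ s *: Q [ffun j =>
    if j == ord0 then hom_cochain b (const1 (v (s ord0))) else v (s j)].
  (* The cochain of b reads only the g-component of a value of Q, which is zero. *)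
  rewrite nr_adE [X in _ - X]big1 ?subr0 // => s _.
  by rewrite /hom_cochain ffunE Qh (lin0 lin_b) -[(0, 0)]/(0 : g * h) scaler0.
have hom0 (v : {ffun 'I_k.+1 -> g * h}) (s : 'S_k.+1) :
  (v (s ord0)).1 = 0 -> Q [ffun j =>
    if j == ord0 then hom_cochain b (const1 (v (s ord0))) else v (s j)] = 0.
  move=> vs0; apply: (Q0 _ ord0); rewrite ffunE eqxx.
  by rewrite /hom_cochain ffunE vs0 (lin0 lin_b).
split=> [v|v i vi|v S mS vS].
- rewrite adE.
  apply: (big_ind (fun u : g * h => u.1 = 0)) => //= [u w u0 w0|s _].
    by rewrite /= u0 w0 addr0.
  by rewrite Qh scaler0.
- rewrite adE big1 // => s _; case: (eqVneq (s ord0) i) => [s0|s0].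
    by rewrite hom0 ?scaler0 // s0 vi.
  rewrite (Q0 _ ((s^-1)%g i)) ?scaler0 // ffunE permKV vi ifN //.
  by apply: contraNneq s0 => <-; rewrite permKV.
- rewrite adE big1 // => s _.
  case: (boolP (s ord0 \in S)) => [s0S|s0S].
    by rewrite hom0 ?scaler0 // vS.
  (* The arguments now in h are the new one in slot 0 and those coming from S. As [s ord0] is not in
     S, slot 0 is not counted twice and the cardinal is #|S| + 1. *)
  rewrite (QS _ (ord0 |: (s @^-1: S))%SET) ?scaler0 //.
    rewrite cardsU1 inE s0S add1n.
    rewrite -(card_imset _ (@perm_inj _ s)) (_ : s @: (s @^-1: S) = S)%SET.
      by case: (m) mS.
    apply/setP => i; apply/imsetP/idP => [[j + ->]|iS]; first by rewrite inE.
    by exists ((s^-1)%g i); rewrite ?inE permKV.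
  move=> i; rewrite !inE ffunE; case: eqP => //= _ siS; exact: vS.
Qed.

Lemma iter_ad_eq0 m k n (Q : cochain (g * h) k.+1) :
  h_filtered m Q -> (m <= n)%N ->
  iter n (nr_ad (hom_cochain b) (q := k)) Q = 0.
Proof.
move=> Qm mn.
have: h_filtered (m - n) (iter n (nr_ad (hom_cochain b) (q := k)) Q).
  elim: n {mn} => [|n IH]; first by rewrite subn0.
  by rewrite subnS; exact: h_filtered_ad.
have /eqP -> : (m - n == 0)%N by rewrite subn_eq0.
case=> _ _ Q0; apply/funext => v; apply: (Q0 v finset.set0) => // i.
by rewrite inE.
Qed.

Lemma h_filtered0 m k : h_filtered m (0 : cochain (g * h) k.+1).
Proof. by []. Qed.

Lemma h_filteredD m k (Q Q' : cochain (g * h) k.+1) :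
  h_filtered m Q -> h_filtered m Q' -> h_filtered m (Q + Q').
Proof.
move=> [Qh Q0 QS] [Qh' Q0' QS']; split=> [v|v i vi|v S mS vS]; rewrite fctE.
- by rewrite /= Qh Qh' addr0.
- by rewrite (Q0 v i) // (Q0' v i) // addr0.
- by rewrite (QS v S) // (QS' v S) // addr0.
Qed.

(** With k + 1 slots, the condition on k + 2 arguments in h is vacuous. *)
Lemma Cgt_h_filtered k (Q : cochain (g * h) k.+1) :
  Cgt Q -> h_filtered k.+2 Q.
Proof.
move=> [G Gbi ->]; rewrite big_nat.
apply: (big_ind (fun F => h_filtered k.+2 F)).
- exact: h_filtered0.
- exact: h_filteredD.
move=> m /Gbi[[Gl _] Gh _]; split=> // [v i vi|v S].
  have := lin0 (Gl i v); rewrite (_ : [ffun j => _] = v) //.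
  by apply/ffunP => j; rewrite ffunE; case: eqP => // ->.
by have := max_card (mem S); rewrite card_ord leqNgt => /negP.
Qed.

Lemma hom_cochain_ad_nilpotent : ad_nilpotent (@Cgt K g h) (hom_cochain b).
Proof.
move=> x [xC [N xN]]; exists N.+1 => k; case: (leqP N k) => [/xN ->|kN].
  exact: (@iter_ad_eq0 0).
(* In the degrees k < N that remain, k + 2 <= N + 1, so one exponent serves all degrees. *)
by apply: (@iter_ad_eq0 k.+2) => //; apply: Cgt_h_filtered.
Qed.

(** Level 2 improves on the general level 3 because there is no C^{0,2} component; hence the square
    of ad_beta already kills chi + psi. *)
Lemma cocycle_h_filtered c : precocycle c -> h_filtered 2 (cocycle_cochain c).
Proof.
case=> chil chir alt psir psil.
have chi0l u : c.1 0 u = 0 := lin0 (chil u).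
have psi0l x : c.2 0 x = 0 := lin0 (psil x).
have chi0r a : c.1 a 0 = 0 := lin0 (chir a).
have psi0r a : c.2 a 0 = 0 := lin0 (psir a).
rewrite /cocycle_cochain; split=> // [v i|v S S2 vS].
  by case: (ord2P i) => -> -> /=;
    rewrite ?chi0l ?chi0r ?psi0l ?psi0r ?addr0 ?subr0.
move: S2 (vS ord0) (vS ord_max); rewrite card_set_ord2.
case: (ord0 \in S) (ord_max \in S) => [] [] // _ /(_ isT) -> /(_ isT) ->.
by rewrite chi0l !psi0l addr0 subr0.
Qed.

(** The bracket with beta sends psi into C^{2,0} and kills chi, because beta takes values in h. *)
Definition ad_pair c : (g -> g -> h) * (g -> h -> h) :=
  (fun x y => c.2 x (b y) - c.2 y (b x), fun _ _ => 0).

Lemma nr_ad_cocycle c : precocycle c ->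
  nr_ad (hom_cochain b) (cocycle_cochain c) = cocycle_cochain (ad_pair c).
Proof.
case=> chil chir alt psir psil.
have chi0l u : c.1 0 u = 0 := lin0 (chil u).
have psi0l x : c.2 0 x = 0 := lin0 (psil x).
rewrite /nr_ad /nr_bracket; apply/funext => v.
have -> : @nr_insert K (g * h)%type 1 0 1 (cocycle_cochain c) (hom_cochain b)
    = 0.
  apply/funext => w.
  by rewrite nr_insert_1_0 /hom_cochain !ffunE (lin0 lin_b).
rewrite scaler0 subr0 nr_insert_0_1 /cocycle_cochain /hom_cochain !ffunE /=.
rewrite !chi0l !psi0l; congr pair => /=; first by rewrite subr0.
by zmod.
Qed.

Definition d_pair : (g -> g -> h) * (g -> h -> h) :=
  (fun x y => b (lie x y), fun x u => - lie (b x) u).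

Lemma nr_d_hom : nr_d (hom_cochain b) = cocycle_cochain d_pair.
Proof.
apply/funext => v; rewrite /nr_d /nr_bracket muln0 expr0 scale1r.
(* The degree [1 + 0] is replaced by the convertible [1] of the insertion lemmas. *)
change (nr_insert (r := 1) (@rho K (g * h)%type) (hom_cochain b) v
  - nr_insert (r := 1) (hom_cochain b) (@rho K (g * h)%type) v
  = cocycle_cochain d_pair v).
rewrite nr_insert_1_0 nr_insert_0_1.
rewrite /rho /cocycle_cochain /hom_cochain !ffunE /=.
rewrite !dsum_lieE /= !lie0l; congr pair => /=; first by zmod.
by zmod.
Qed.

Lemma d_pair_precocycle : precocycle d_pair.
Proof.
split=> /= [y a u w|x a u w|x|x a u w|x a u w].
- by rewrite lie_linearl lin_b.
- by rewrite lie_linearr lin_b.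
- by rewrite liexx (lin0 lin_b).
- by rewrite lie_linearr opprD scalerN.
- by rewrite lin_b lie_linearl opprD scalerN.
Qed.

Lemma fsum_nat2 (V : zmodType) (F : nat -> V) :
  (forall n, (1 < n)%N -> F n = 0) ->
  \sum_(n \in [set: nat]) F n = F 0%N + F 1%N.
Proof.
move=> F0; rewrite (@fsbigE _ _ _ _ _ [:: 0%N; 1%N]) //.
  by rewrite !big_cons big_nil !classical_sets.in_setT /= addr0.
by case=> [|[|n]] // _ _; exact: F0.
Qed.

Definition gauge_pair c : (g -> g -> h) * (g -> h -> h) :=
  (fun x y => c.1 x y + c.2 x (b y) - c.2 y (b x) - b (lie x y)
              + lie (b x) (b y),
   fun x u => c.2 x u + lie (b x) u).

Lemma exp_ad_cocycle c : precocycle c ->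
  exp_ad (hom_cochain b) (cocycle_cochain c) =
  cocycle_cochain c + cocycle_cochain (ad_pair c).
Proof.
move=> pre_c; rewrite /exp_ad fsum_nat2 => [|n n2].
  by rewrite /= invr1 !scale1r nr_ad_cocycle.
by rewrite (iter_ad_eq0 (cocycle_h_filtered pre_c)) // scaler0.
Qed.

Lemma gauge_shift_hom :
  gauge_shift (hom_cochain b) =
  - (cocycle_cochain d_pair + 2%:R^-1 *: cocycle_cochain (ad_pair d_pair)).
Proof.
rewrite /gauge_shift nr_d_hom fsum_nat2 => [|n n2].
  by rewrite /= invr1 scale1r (nr_ad_cocycle d_pair_precocycle).
by rewrite (iter_ad_eq0 (cocycle_h_filtered d_pair_precocycle)) // scaler0.
Qed.

(** The quadratic term [b x, b y] comes from -1/2 ad_beta (d beta): [ad_pair] of [d_pair] is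
    -[b x, b y] + [b y, b x], that is -2 [b x, b y]. *)
Lemma gauge_action_cocycle c : 2%:R != 0 :> K -> precocycle c ->
  exp_ad (hom_cochain b) (cocycle_cochain c) + gauge_shift (hom_cochain b)
  = cocycle_cochain (gauge_pair c).
Proof.
move=> nz2 pre_c; rewrite exp_ad_cocycle // gauge_shift_hom.
apply/funext => v; rewrite !fctE /cocycle_cochain /=.
have half (x : h) : 2%:R^-1 *: (- x - x) = - x.
  by rewrite -opprD -mulr2n -scaler_nat scalerN scalerA mulVf // scale1r.
rewrite (lieC (b (v ord_max).1) (b _)) !opprK.
congr pair => /=; first by rewrite scaler0; zmod.
rewrite !subr0 !addr0 half; zmod.
Qed.

End Gauge.

(** * The bijection on classes *)

Lemma image_eqclass (T U : Type) (A : set T) (B : set U) (R : T -> T -> Prop)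
    (R' : U -> U -> Prop) (phi : T -> U) (x : T) :
  set_bij A B phi -> (forall x y, A x -> A y -> R x y <-> R' (phi x) (phi y)) ->
  A x -> phi @` eqclass A R x = eqclass B R' (phi x).
Proof.
move=> [phiAB _ phi_surj] RR' Ax.
apply/seteqP; split=> [_ [y [Ay Rxy] <-]|z [Bz Rxz]].
  by split; [exact: phiAB|exact/RR'].
have [y Ay yz] := phi_surj z Bz; exists y => //; split=> //.
by apply/RR'; rewrite ?yz.
Qed.

(** Direct image carries the class of x onto the class of [phi x]. If two classes have the same
    image, injectivity of [phi] on A identifies their members. *)
Lemma image_quotient_bij (T U : Type) (A : set T) (B : set U)
    (R : T -> T -> Prop) (R' : U -> U -> Prop) (phi : T -> U) :
  set_bij A B phi -> (forall x y, A x -> A y -> R x y <-> R' (phi x) (phi y)) ->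
  set_bij (quotient_set A R) (quotient_set B R') (image^~ phi).
Proof.
move=> bij_phi RR'; have [phiAB phi_inj phi_surj] := bij_phi; split.
- move=> _ [x Ax <-]; exists (phi x); first exact: phiAB.
  by rewrite (image_eqclass bij_phi RR').
- suff sub x y : A x -> A y -> phi @` eqclass A R x = phi @` eqclass A R y ->
      eqclass A R x `<=` eqclass A R y.
    move=> _ _ /set_mem[x Ax <-] /set_mem[y Ay <-] E.
    by apply/seteqP; split; apply: sub.
  move=> Ax Ay E z xz.
  have : (phi @` eqclass A R y) (phi z) by rewrite -E; exists z.
  move=> [w yw wz]; rewrite -(phi_inj w z) ?inE //; [exact: yw.1|exact: xz.1].
- move=> _ [z Bz <-]; have [x Ax xz] := phi_surj z Bz.
  by exists (eqclass A R x); [exists x|rewrite (image_eqclass bij_phi RR') ?xz].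
Qed.

Section Comparison.
Variables (K : fieldType) (g h : lieAlgType K).
Hypothesis nz2 : 2%:R != 0 :> K.

Lemma cocycle_cochain_bij :
  set_bij (@Z2nab K g h) (MC (@Cgt K g h)) (@cocycle_cochain K g h).
Proof.
split=> [c Zc|c c' /set_mem Zc /set_mem Zc' |F [/Cgt1P[c pre_c ->] MCc]].
- have [pre_c MCc] := (Z2nab_iff c nz2).1 Zc.
  by split=> //; exact: precocycle_Cgt.
- have [chil chir _ psir psil] := Z2nab_precocycle Zc.
  have [chil' chir' _ psir' psil'] := Z2nab_precocycle Zc'.
  apply: cocycle_cochain_inj => a;
    [exact: lin0 (chir a)|exact: lin0 (psir a)|exact: lin0 (psil a)
    |exact: lin0 (chir' a)|exact: lin0 (psir' a)|exact: lin0 (psil' a)].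
- by exists c => //; apply/Z2nab_iff.
Qed.

Lemma gauge_pair_inj (b : g -> h) c c' :
  linear b -> precocycle c -> precocycle c' ->
  cocycle_cochain c' = cocycle_cochain (gauge_pair b c) -> c' = gauge_pair b c.
Proof.
move=> lin_b [chil chir _ psir psil] [chil' chir' _ psir' psil'].
have b0 := lin0 lin_b.
apply: cocycle_cochain_inj => a /=;
  [exact: lin0 (chir' a)|exact: lin0 (psir' a)|exact: lin0 (psil' a)|..].
- by rewrite (lin0 (chir a)) b0 (lin0 (psir a)) (lin0 (psil _)) !lie0r b0; zmod.
- by rewrite (lin0 (psir a)) lie0r addr0.
- by rewrite (lin0 (psil a)) b0 lie0l addr0.
Qed.

Lemma nab_equiv_gauge c c' : Z2nab c -> Z2nab c' ->
  nab_equiv c c' <->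
  gauge_equiv (@Cgt K g h) (cocycle_cochain c) (cocycle_cochain c').
Proof.
move=> /Z2nab_precocycle pre_c /Z2nab_precocycle pre_c'; split.
  move=> [b [lin_b psiE chiE]]; exists (hom_cochain b); split.
  - by apply/Cgt0P; exists b.
  - exact: hom_cochain_ad_nilpotent.
  rewrite gauge_action_cocycle //; congr cocycle_cochain.
  by rewrite [LHS]surjective_pairing; congr pair; do 2 apply/funext => ?.
(* Every gauge parameter in L^0 is a linear map from g to h. *)
move=> [_ [/Cgt0P[b lin_b ->] _]]; rewrite gauge_action_cocycle //.
by move=> /(gauge_pair_inj lin_b pre_c pre_c') ->; exists b.
Qed.

End Comparison.

Theorem theorem2p1 (K : fieldType) (g h : lieAlgType K)
    (charK0 : [pchar K] =i pred0) :
  set_fun (@Z2nab K g h) (MC (@Cgt K g h)) (@cocycle_cochain K g h) /\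
  exists f : set ((g -> g -> h) * (g -> h -> h)) ->
             set (cochain (g * h)%type 2),
    set_bij (@H2nab K g h) (MC_classes (@Cgt K g h)) f /\
    forall c, Z2nab c ->
      f (eqclass (@Z2nab K g h) (@nab_equiv K g h) c) =
      eqclass (MC (@Cgt K g h)) (gauge_equiv (@Cgt K g h))
        (cocycle_cochain c).
Proof.
(* Characteristic zero enters through the invertibility of 2, for the halves in the Maurer-Cartan
   equation and in the gauge shift. *)
have nz2 : 2%:R != 0 :> K by have := charK0 2; rewrite inE /= => /negbT.
have bij_phi := @cocycle_cochain_bij K g h nz2.
have equivE := @nab_equiv_gauge K g h nz2.
split; first by case: bij_phi.
exists (image^~ (@cocycle_cochain K g h)); split.
  exact: image_quotient_bij.
by move=> c Zc; exact: image_eqclass.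
Qed.
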